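(* Let $S\neq\mathbb{N}$ be a numerical semigroup with $c(S)\le 2m(S)$. Then $W(S)=0$ if and only if $S=T_{m,1}$ or $S=T_{m,2}$ for some integer $m\ge2$, or $S=\langle 3,4\rangle$.
   Context: $\mathbb{N}=\{0,1,2,\dots\}$. A numerical semigroup is a submonoid $S\subseteq\mathbb{N}$ (under addition) with finite complement. Let $S\ne\mathbb{N}$. The multiplicity $m(S)$ is the least positive element of $S$; $F$ is the largest element of $\mathbb{N}\setminus S$, $c(S)=F+1$ is the conductor, and $n(S)=|S\cap[0,c(S))|$. The embedding dimension $e(S)$ is the cardinality of the unique minimal system of generators of $S$. The Wilf number is $W(S)=e(S)n(S)-c(S)$. $\langle a_1,\dots,a_r\rangle$ denotes the submonoid of $\mathbb{N}$ generated by $a_1,\dots,a_r$. For $m\ge2$ and $k\ge1$, $$T_{m,k}=\{0,m,2m,\dots,(k-1)m\}\cup\{x\in\mathbb{N}: x\ge km\};$$ thus $T_{m,1}=\langle m,m+1,\dots,2m-1\rangle$ and $T_{m,2}=\langle m,2m+1,\dots,3m-1\rangle$. *)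

(* Defs.v *)
From mathcomp Require Import all_boot all_order all_algebra finmap.
From mathcomp Require Import boolp classical_sets functions cardinality.

Set Implicit Arguments.
Unset Strict Implicit.
Unset Printing Implicit Defensive.

Local Open Scope classical_set_scope.

Definition submonoid (M : set nat) : Prop :=
  M 0 /\ forall x y, M x -> M y -> M (x + y).

Definition numerical_semigroup (S : set nat) : Prop :=
  submonoid S /\ finite_set (~` S).

Definition generated (A : set nat) : set nat := smallest submonoid A.

(* [xget x0 P] is the definite description "the x such that P x"; the value
   [x0] is only taken when no such x exists. *)

Definition multiplicity (S : set nat) : nat :=
  let pos := [set x | S x /\ 0 < x] in
  xget 0 [set x | pos x /\ forall y, pos y -> x <= y].

Definition frobenius (S : set nat) : nat :=
  xget 0 [set x | (~` S) x /\ forall y, (~` S) y -> y <= x].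

(* Meaningful only when [~` S] is nonempty, i.e. [S <> setT]. *)
Definition conductor (S : set nat) : nat := (frobenius S).+1.

Definition left_count (S : set nat) : nat :=
  #|` fset_set (S `&` [set x | x < conductor S])|.

Definition minimal_system_of_generators (S A : set nat) : Prop :=
  generated A = S /\ forall B, B `<=` A -> generated B = S -> B = A.

Definition embedding_dimension (S : set nat) : nat :=
  #|` fset_set (xget set0 (minimal_system_of_generators S))|.

Definition wilf_number (S : set nat) : int :=
  ((embedding_dimension S)%:Z * (left_count S)%:Z - (conductor S)%:Z)%R.

Definition Tsemigroup (m k : nat) : set nat :=
  [set i * m | i in [set i | i < k]] `|` [set x | k * m <= x].

(* Main.v *)
(* Write m and c for the multiplicity and the conductor, and let k be the number
   of elements of S in [m, c), so that n(S) = k + 1.  When c <= 2m these k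
   elements are minimal generators, and the other ones are the elements of
   [c, c + m) which are not a sum of two of the k.  Hence e(S) = k + m - d, where
   d <= m and d <= k(k+1)/2.  For k <= 1 the equation e(S) n(S) = c is read off
   directly.  For k >= 2 it forces c = 2m and d = m = k(k+1)/2, that is, every
   element of [2m, 3m) is a sum of two of the k elements in exactly one way;
   this is possible only for k = 2, which gives <3, 4>. *)
Require Import Defs.
From mathcomp Require Import all_boot all_order all_algebra.
From mathcomp Require Import boolp classical_sets functions cardinality.
From mathcomp Require Import finmap zify.

Set Implicit Arguments.
Unset Strict Implicit.
Unset Printing Implicit Defensive.

Local Open Scope classical_set_scope.

(** * Sums of two elements of a list *)

Fixpoint pair_sums (s : seq nat) : seq nat :=
  if s is a :: s' then [seq a + x | x <- s] ++ pair_sums s' else [::].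

Lemma pair_sums_cons a s :
  pair_sums (a :: s) = [seq a + x | x <- a :: s] ++ pair_sums s.
Proof. by []. Qed.

(** Each unordered pair of positions, the diagonal included, contributes exactly one entry;
    coinciding sums are kept. *)
Lemma size_pair_sums s : 2 * size (pair_sums s) = size s * (size s).+1.
Proof.
elim: s => //= a s IH.
rewrite size_cat size_map; nia.
Qed.

Lemma mem_pair_sums s x y : x \in s -> y \in s -> x + y \in pair_sums s.
Proof.
elim: s => // a s IH xs ys; rewrite pair_sums_cons mem_cat.
move: (xs) (ys); rewrite (in_cons a s x) (in_cons a s y).
move=> /predU1P[->|xs'] /predU1P[->|ys'].
- by rewrite (map_f (addn a) (mem_head a s)).
- by rewrite (map_f (addn a) ys).
- by rewrite addnC (map_f (addn a) xs).
- by rewrite IH // orbT.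
Qed.

Lemma pair_sumsP s t : t \in pair_sums s ->
  exists x y, [/\ x \in s, y \in s & t = x + y].
Proof.
elim: s => // a s IH; rewrite pair_sums_cons mem_cat => /orP[/mapP[y ys ->]|/IH].
  by exists a, y; rewrite mem_head.
by move=> [x [y [xs ys ->]]]; exists x, y; rewrite !inE xs ys !orbT.
Qed.

(** By induction on [s]: as soon as one of the four entries is the head [a], the other side of the
    equation contains [a] too, and it cancels. This is the Sidon property of [s]. *)
Lemma uniq_pair_sums_inj s x y z w : uniq (pair_sums s) ->
  x \in s -> y \in s -> z \in s -> w \in s -> x + y = z + w ->
  x = z \/ x = w.
Proof.
elim: s => [//|a s IH].
rewrite pair_sums_cons cat_uniq => /and3P[_ /hasPn dis us].
(* With [u] and [v] both in the tail, the sum would occur in the row of [a] and again in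
   [pair_sums s]. *)
have inj_a u v t : t \in a :: s -> u \in a :: s -> v \in a :: s ->
    a + t = u + v -> u = a \/ v = a.
  move=> ts; rewrite (in_cons a s u) (in_cons a s v).
  move=> /predU1P[->|us']; first by left.
  move=> /predU1P[->|vs'] E; first by right.
  have /negP := dis _ (mem_pair_sums us' vs'); case.
  by rewrite -E; exact: (map_f (addn a) ts).
move=> xs ys zs ws E.
move: (xs); rewrite (in_cons a s x) => /predU1P[xa|xs'].
  have [||] := inj_a z w y ys zs ws; clear -xa E; lia.
move: (ys); rewrite (in_cons a s y) => /predU1P[ya|ys'].
  have [||] := inj_a z w x xs zs ws; clear -ya E; lia.
move: (zs); rewrite (in_cons a s z) => /predU1P[za|zs'].
  have [||] := inj_a x y w ws xs ys; clear -za E; lia.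
move: (ws); rewrite (in_cons a s w) => /predU1P[wa|ws'].
  have [||] := inj_a x y z zs xs ys; clear -wa E; lia.
exact: IH.
Qed.

(* Writing [s = m + B], the hypotheses force every [t < m] to be uniquely a sum
   of two elements of [B], and no such sum to reach [m].  Then 0, 1, 3, 5 are
   successively forced into [B], and 1 + 5 = 3 + 3. *)
Lemma no_perfect_additive_basis m s : 6 <= m -> all (leq m) s ->
  size (pair_sums s) <= m -> {subset iota (2 * m) m <= pair_sums s} -> False.
Proof.
move=> m6 /allP sm szs sub.
(* At most [m] entries cover [m] distinct values, so none is repeated. *)
have us : uniq (pair_sums s).
  apply: leq_size_uniq (iota_uniq (2 * m) m) sub _.
  by rewrite size_iota.
have cov t : t < m -> exists x y,
    [/\ m + x \in s, m + y \in s & t = x + y].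
  move=> tm; have /sub/pair_sumsP[x [y [xs ys E]]] : 2 * m + t \in iota (2 * m) m.
    by rewrite mem_iota; lia.
  have mx := sm _ xs; have my := sm _ ys.
  by exists (x - m), (y - m); rewrite !subnKC //; split=> //; lia.
have inj x y z w : m + x \in s -> m + y \in s -> m + z \in s -> m + w \in s ->
    x + y = z + w -> x = z \/ x = w.
  move=> xs ys zs ws E.
  have := uniq_pair_sums_inj us xs ys zs ws; lia.
have m4 : 3 < m by lia.
have s0 : m + 0 \in s.
  case: (cov 0) => [|x [y [xs ys E]]]; first lia.
  by have -> : 0 = x by lia.
have s1 : m + 1 \in s.
  case: (cov 1) => [|[|[|x]] [y [xs ys E]]] //; try lia.
  by have -> : 1 = y by lia.
have s2 : m + 2 \notin s.
  by apply/negP => h; case: (inj _ _ _ _ h s0 s1 s1).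
have s3 : m + 3 \in s.
  by case: (cov 3 m4) => [[|[|[|[|x]]]] [[|[|[|[|y]]]] [xs ys]]] //;
    case/negP: s2.
have s4 : m + 4 \notin s.
  by apply/negP => h; case: (inj _ _ _ _ h s0 s1 s3).
have s5 : m + 5 \in s.
  by case: (cov 5 m6) => [[|[|[|[|[|[|x]]]]]] [[|[|[|[|[|[|y]]]]]] [xs ys]]] //;
    solve [case/negP: s2 => // | case/negP: s4 => //].
by case: (inj _ _ _ _ s1 s5 s3 s3).
Qed.

(** Put [e = k + m - d]. Since [d <= m], [e >= k], so [k(k+1) <= e(k+1) = c <= 2m]. Conversely,
    multiplying [2m = 2e + 2d - 2k] by [k+1] and using the bounds on [c] and [2d] gives
    [(k-1) 2m <= (k-1) k(k+1)], where [k - 1 > 0] cancels. Hence equality holds throughout. *)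
Lemma wilf_arithmetic k m d c : 2 <= k -> c <= 2 * m -> d <= m ->
  2 * d <= k * k.+1 -> (k + m - d) * k.+1 = c ->
  [/\ d = m, c = 2 * m & 2 * m = k * k.+1].
Proof.
move=> k2 cm dm dk E.
set e := k + m - d in E.
have ed : e + d = k + m by rewrite /e; lia.
have ke : k <= e by lia.
have km : k * k.+1 <= 2 * m by apply: leq_trans cm; rewrite -E leq_mul2r ke orbT.
have H : (k - 1) * (2 * m) <= (k - 1) * (k * k.+1) by nia.
have mk : 2 * m <= k * k.+1 by move: H; rewrite leq_pmul2l //; lia.
have mE : 2 * m = k * k.+1 by lia.
have ek : e <= k.
  have : e * k.+1 <= k * k.+1 by rewrite E -mE.
  by rewrite leq_pmul2r.
split; nia.
Qed.

(** * Evaluation of multiplicity, conductor and cardinalities *)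

Lemma card_fset_set_count (A : set nat) N : (forall x, A x -> x < N) ->
  #|` fset_set A| = count (fun x => `[< A x >]) (iota 0 N).
Proof.
move=> AN.
have fA : finite_set A by apply: sub_finite_set (finite_II N) => x /AN.
have -> : fset_set A = [fset x in [seq x <- iota 0 N | `[< A x >]]]%fset.
  apply/fsetP => x; rewrite in_fset_set // inE mem_filter mem_iota /= add0n.
  apply/idP/andP => [/set_mem Ax|[/asboolP Ax _]]; last exact/mem_set.
  by rewrite AN // asboolT.
by rewrite card_fseq undup_id ?filter_uniq ?iota_uniq // size_filter.
Qed.

Lemma wilf_number_eq0 S : wilf_number S = 0%R <->
  embedding_dimension S * left_count S = conductor S.
Proof.
rewrite /wilf_number; lia.
Qed.

Lemma multiplicityE S m : S m -> 0 < m -> (forall x, S x -> 0 < x -> m <= x) ->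
  multiplicity S = m.
Proof.
move=> Sm m0 mmin; rewrite /multiplicity.
case: xgetP => [x _ [[Sx x0] xmin]|/(_ m) []].
  by apply/eqP; rewrite eqn_leq xmin //= mmin.
by split=> // y [Sy y0]; exact: mmin.
Qed.

Lemma conductorE S f : ~ S f -> (forall x, f < x -> S x) -> conductor S = f.+1.
Proof.
move=> Sf fmax; rewrite /conductor /frobenius; congr _.+1.
have le y : ~ S y -> y <= f by move=> Sy; rewrite leqNgt; apply/negP => /fmax.
case: xgetP => [x _ [Sx xmax]|/(_ f) []].
  by apply/eqP; rewrite eqn_leq (le x) //= xmax.
by split.
Qed.

Lemma finite_set_nat_ub (A : set nat) : finite_set A ->
  exists N, forall x, A x -> x <= N.
Proof.
move=> /finite_seqP[s ->]; exists (\max_(i <- s) i) => x /= xs.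
exact: leq_bigmax_seq.
Qed.

Lemma multiplicity_spec S : numerical_semigroup S ->
  [/\ S (multiplicity S), 0 < multiplicity S &
      forall x, S x -> 0 < x -> multiplicity S <= x].
Proof.
move=> [_ /finite_set_nat_ub[N HN]].
have ex : exists x, `[< S x >] && (0 < x).
  exists N.+1; rewrite andbT; apply/asboolP; apply: contrapT => /HN.
  by rewrite ltnn.
case: (ex_minnP ex) => m /andP[/asboolP Sm m0] mmin.
have mmin' x : S x -> 0 < x -> m <= x.
  by move=> Sx x0; apply: mmin; rewrite x0 andbT; apply/asboolP.
by rewrite (@multiplicityE S m).
Qed.

Lemma conductor_spec S : numerical_semigroup S -> S <> setT ->
  ~ S (conductor S).-1 /\ forall x, conductor S <= x -> S x.
Proof.
move=> [_ /finite_set_nat_ub[N HN]] ST.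
have ex : exists x, `[< ~ S x >].
  apply: contrapT => H; apply: ST; apply/seteqP; split=> // x _.
  by apply: contrapT => Sx; apply: H; exists x; apply/asboolP.
have bd x : `[< ~ S x >] -> x <= N by move=> /asboolP /HN.
case: (ex_maxnP ex bd) => f /asboolP Sf fmax.
have fmax' x : f < x -> S x.
  move=> fx; apply: contrapT => Sx.
  by have := fmax x; rewrite leqNgt fx asboolT // => /(_ isT).
by rewrite (conductorE Sf fmax').
Qed.

Lemma multiplicity_gt1 S : numerical_semigroup S -> S <> setT ->
  1 < multiplicity S.
Proof.
move=> Snum ST; have [[[S0 SD] _] [Sm m0 _]] := (Snum, multiplicity_spec Snum).
rewrite ltn_neqAle m0 andbT; apply/eqP => m1; apply: ST.
apply/seteqP; split=> // x _; elim: x => // x Sx.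
by rewrite -addn1; apply: SD => //; rewrite m1.
Qed.

Lemma multiplicity_le_conductor S : numerical_semigroup S -> S <> setT ->
  multiplicity S <= conductor S.
Proof.
move=> Snum ST; have [_ m0 mmin] := multiplicity_spec Snum.
have [_ Sc] := conductor_spec Snum ST; have m1 := multiplicity_gt1 Snum ST.
rewrite leqNgt; apply/negP => cm.
(* If [c < m], then [m - 1 >= c] would be a positive element of [S] below [m]. *)
have : multiplicity S <= (multiplicity S).-1 by apply: mmin; [apply: Sc|]; lia.
lia.
Qed.

(** * The minimal system of generators *)

Definition decomposable (S : set nat) (x : nat) : Prop :=
  exists a b, [/\ S a, S b, 0 < a, 0 < b & x = a + b].

Definition atoms (S : set nat) : set nat :=
  [set x | [/\ S x, 0 < x & ~ decomposable S x]].

Lemma generated_submonoid A : submonoid (generated A).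
Proof.
split=> [M [[]] //|x y Ax Ay M MA].
by have [[_ MD] _] := MA; apply: MD; [exact: Ax|exact: Ay].
Qed.

Lemma sub_generated A : A `<=` generated A.
Proof. exact: sub_smallest. Qed.

Lemma generated_min A M : submonoid M -> A `<=` M -> generated A `<=` M.
Proof. by move=> MM AM; exact: smallest_sub. Qed.

(** Strong induction: a positive element that is not an atom splits into two smaller elements of
    [S]. *)
Lemma generated_atoms S : submonoid S -> generated (atoms S) = S.
Proof.
move=> SM; apply/seteqP; split; first by apply: generated_min => // x [].
have [G0 GD] := generated_submonoid (atoms S).
elim/ltn_ind => x IH Sx.
have [->//|x0] := posnP x.
have [[a [b [Sa Sb a0 b0 E]]]|nd] := pselect (decomposable S x).
  by rewrite E; apply: GD; apply: IH => //; lia.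
exact: sub_generated.
Qed.

(** Removing an atom [x] from [S] leaves a submonoid, so a set [A] missing [x] generates only a part
    of it. *)
Lemma atoms_sub_generators S A : submonoid S -> generated A = S ->
  atoms S `<=` A.
Proof.
move=> [S0 SD] AS x [Sx x0 nd]; apply: contrapT => Ax.
have : generated A `<=` [set y | S y /\ y <> x].
  apply: generated_min => [|y Ay].
    split=> [|a b [Sa ax] [Sb bx]]; first by split=> //; lia.
    split; first exact: SD.
    move=> E; apply: nd; exists a, b; split=> //; rewrite lt0n;
      by apply/eqP => z; subst; rewrite ?addn0 in ax bx *.
  by split; [rewrite -AS; exact: sub_generated|move=> E; rewrite E in Ay].
by rewrite AS => /(_ _ Sx)[].
Qed.

Lemma embedding_dimensionE S : submonoid S ->
  embedding_dimension S = #|` fset_set (atoms S)|.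
Proof.
move=> SM; rewrite /embedding_dimension.
case: xgetP => [A _ [AS Amin]|/(_ (atoms S)) []].
  have -> // := Amin (atoms S).
    exact: atoms_sub_generators.
  exact: generated_atoms.
split; first exact: generated_atoms.
move=> B BA BS; apply/seteqP; split=> //; exact: atoms_sub_generators.
Qed.

(** * Counting generators when [m <= c <= 2m] *)

Section counting.
Variables (S : set nat) (m c : nat).
Hypotheses (SM : submonoid S) (Sm : S m) (m0 : 0 < m).
Hypothesis mmin : forall x, S x -> 0 < x -> m <= x.
Hypotheses (Sc : forall x, c <= x -> S x) (mc : m <= c) (c2m : c <= 2 * m).

Definition low_elements := [seq x <- iota m (c - m) | `[< S x >]].
(** The window [[c, c + m)] is the only undecided range: sums of two positive elements are at least
    [2m >= c], and every [x >= c + m] is [m + (x - m)] with [x - m] in [S]. *)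
Definition decomposables := [seq x <- iota c m | `[< decomposable S x >]].

Lemma mem_low x : x \in low_elements = [&& `[< S x >], m <= x & x < c].
Proof. by rewrite mem_filter mem_iota subnKC. Qed.

(** The successor accounts for 0, the only element of [S] below [m]. *)
Lemma count_below_conductor :
  count (fun x => `[< S x >]) (iota 0 c) = (size low_elements).+1.
Proof.
rewrite -{1}(subnKC mc) iotaD count_cat add0n size_filter -add1n; congr (_ + _).
case: m m0 mmin => // m' _ min' /=.
rewrite asboolT; last by case: SM.
rewrite (eq_in_count (a2 := pred0)) ?count_pred0 // => x.
rewrite mem_iota => xm; apply/asboolPn => /min'; lia.
Qed.

Lemma left_count_low : conductor S = c -> left_count S = (size low_elements).+1.
Proof.
move=> cE; rewrite /left_count cE (@card_fset_set_count _ c) => [|x []//].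
rewrite -count_below_conductor; apply: eq_in_count => x.
rewrite mem_iota => /= xc; apply/asbool_equiv_eq; split=> [[]//|]; split=> //.
Qed.

(** Each summand is at least [m], which forces the other below [c]. *)
Lemma decomposable_low x : decomposable S x -> x < c + m ->
  exists a b, [/\ a \in low_elements, b \in low_elements & x = a + b].
Proof.
move=> [a [b [Sa Sb a0 b0 E]]] xcm; exists a, b.
have ma := mmin Sa a0; have mb := mmin Sb b0.
by rewrite !mem_low !asboolT //; split=> //; lia.
Qed.

Lemma sub_decomposables : {subset decomposables <= pair_sums low_elements}.
Proof.
move=> x; rewrite mem_filter mem_iota => /andP[/asboolP dx /andP[_ xcm]].
have [a [b [La Lb ->]]] := decomposable_low dx xcm.
exact: mem_pair_sums.
Qed.

Lemma size_decomposables_le : size decomposables <= m.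
Proof. by rewrite size_filter (leq_trans (count_size _ _)) // size_iota. Qed.

Lemma size_decomposables_le_low :
  2 * size decomposables <= size low_elements * (size low_elements).+1.
Proof.
rewrite -size_pair_sums leq_mul2l /=; apply: uniq_leq_size sub_decomposables.
by rewrite filter_uniq ?iota_uniq.
Qed.

(** Atoms are counted by range: none in [[0, m)], all of [S] in [[m, c)], the indecomposable numbers
    in [[c, c + m)], and none beyond. *)
Lemma embedding_dimension_low :
  embedding_dimension S = size low_elements + m - size decomposables.
Proof.
rewrite embedding_dimensionE // (@card_fset_set_count _ (c + m)); last first.
  move=> x [Sx x0 nd]; rewrite ltnNge; apply/negP => cx; apply: nd.
  by exists m, (x - m); split=> //; [apply: Sc|..]; lia.
rewrite -{1}(subnKC mc) !iotaD !count_cat !add0n subnKC //.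
have -> : count (fun x => `[< atoms S x >]) (iota 0 m) = 0.
  rewrite (eq_in_count (a2 := pred0)) ?count_pred0 // => x.
  rewrite mem_iota => xm; apply/asboolPn => -[/mmin]; lia.
have -> : count (fun x => `[< atoms S x >]) (iota m (c - m)) =
    size low_elements.
  rewrite size_filter; apply: eq_in_count => x; rewrite mem_iota => xm.
  apply/asbool_equiv_eq; split=> [[]//|Sx]; split=> //; first lia.
  move=> [a [b [Sa Sb /(mmin Sa) + /(mmin Sb)]]]; lia.
have : count (fun x => `[< atoms S x >]) (iota c m) + size decomposables = m.
  rewrite size_filter -[RHS](size_iota c m).
  rewrite -(count_predC (fun x => `[< decomposable S x >])) addnC; congr (_ + _).
  apply: eq_in_count => x; rewrite mem_iota => xm /=.
  rewrite -asbool_neg; apply/asbool_equiv_eq; split=> [[]//|nd].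
  by split=> //; [apply: Sc|]; lia.
lia.
Qed.

End counting.

(** * Membership in the three kinds of semigroups *)

Lemma Tsemigroup1E m x : Tsemigroup m 1 x <-> x = 0 \/ m <= x.
Proof.
rewrite /Tsemigroup /= mul1n; split=> [[[i /= i1 <-]|]|[->|]]; auto.
- by left; case: i i1.
- by left; exists 0.
Qed.

Lemma Tsemigroup2E m x : Tsemigroup m 2 x <-> [\/ x = 0, x = m | 2 * m <= x].
Proof.
rewrite /Tsemigroup /=; split=> [[[i /= i1 <-]|]|[->|->|]].
- case: i i1 => [|[|]] // _; first by constructor 1.
  by constructor 2; rewrite mul1n.
- by constructor 3.
- by left; exists 0.
- by left; exists 1; rewrite ?mul1n.
- by right.
Qed.

Lemma generated34E x : generated [set 3; 4] x <-> [\/ x = 0, x = 3, x = 4 | 6 <= x].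
Proof.
have [G0 GD] := generated_submonoid [set 3; 4].
have G3 : generated [set 3; 4] 3 by apply: sub_generated; left.
have G4 : generated [set 3; 4] 4 by apply: sub_generated; right.
split; last first.
  move=> [->|->|->|] //; elim/ltn_ind: x => x IH x6.
  (* 6, 7 and 8 are sums of two generators; larger numbers descend by 3. *)
  have [xe|[xe|[xe|x9]]] : x = 3 + 3 \/ x = 3 + 4 \/ x = 4 + 4 \/ 9 <= x by lia.
  - by rewrite xe; exact: GD.
  - by rewrite xe; exact: GD.
  - by rewrite xe; exact: GD.
  - by rewrite -(subnKC (leq_trans (isT : 3 <= 9) x9)); apply: GD => //; apply: IH; lia.
suff H : generated [set 3; 4] `<=` [set x | [\/ x = 0, x = 3, x = 4 | 6 <= x]].
  by move/H.
apply: generated_min => [|y [->|->]]; [|by constructor 2|by constructor 3].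
split=> [|a b /= Ha Hb]; first by constructor 1.
have : a + b = 0 \/ a + b = 3 \/ a + b = 4 \/ 6 <= a + b.
  case: Ha Hb => ? [] ?; lia.
by move=> [|[|[|]]] ?; [constructor 1|constructor 2|constructor 3|constructor 4].
Qed.

(** * Classification of the semigroups with Wilf number 0 *)

Lemma wilf_number_eq0_low S m c : numerical_semigroup S -> S <> setT ->
  multiplicity S = m -> conductor S = c -> c <= 2 * m ->
  wilf_number S = 0%R <->
  (size (low_elements S m c) + m - size (decomposables S m c)) *
    (size (low_elements S m c)).+1 = c.
Proof.
move=> Snum ST mE cE c2m; rewrite wilf_number_eq0.
have [Sm m0 mmin] := multiplicity_spec Snum.
have [_ Sc] := conductor_spec Snum ST.
have mc := multiplicity_le_conductor Snum ST.
rewrite mE in Sm m0 mmin mc; rewrite cE in Sc mc.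
rewrite (embedding_dimension_low Snum.1 Sm m0 mmin Sc mc c2m).
by rewrite (left_count_low Snum.1 m0 mmin mc c2m cE) cE.
Qed.

Lemma wilf_number_eq0_cases S : numerical_semigroup S -> S <> setT ->
  conductor S <= 2 * multiplicity S -> wilf_number S = 0%R ->
  [\/ S = Tsemigroup (multiplicity S) 1, S = Tsemigroup (multiplicity S) 2 |
      S = generated [set 3; 4]].
Proof.
move=> Snum ST c2m.
move/(wilf_number_eq0_low Snum ST (erefl _) (erefl _) c2m).
have [Sm m0 mmin] := multiplicity_spec Snum.
have [Sc1 Sc] := conductor_spec Snum ST.
have mc := multiplicity_le_conductor Snum ST.
have [[S0 _] _] := Snum.
move: (multiplicity S) (conductor S) c2m Sm m0 mmin Sc1 Sc mc => m c.
move=> c2m Sm m0 mmin Sc1 Sc mc.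
have S0m x : S x -> x = 0 \/ m <= x.
  by move=> Sx; have [->|x0] := posnP x; [left|right; exact: mmin].
have dm := size_decomposables_le S m c.
have dk := size_decomposables_le_low m0 mmin mc c2m.
have := sub_decomposables m0 mmin mc c2m.
have lowP := mem_low S mc.
case: (ltngtP m c) mc => // [mc _|mcE _ _ _]; last first.
  constructor 1; apply/seteqP; split=> x; rewrite Tsemigroup1E.
    exact: S0m.
  by move=> [->//|]; rewrite mcE; exact: Sc.
have mlow : m \in low_elements S m c by rewrite lowP asboolT // leqnn.
move: dm dk.
set d := size (decomposables S m c); set k := size (low_elements S m c).
move=> dm dk subd W.
have [k1|k2] := leqP k 1.
  have kE : k = 1 by apply/eqP; rewrite eqn_leq k1 -has_predT; apply/hasP; exists m.
  (* Here [d <= 1], so [2(m + 1 - d) = c <= 2m] leaves only [d = 1] and [c = 2m]. *)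
  rewrite kE in dk W; have cE : c = 2 * m by lia.
  have lowE : low_elements S m c = [:: m].
    move: kE mlow; rewrite /k; case: (low_elements S m c) => [|y []] // _.
    by rewrite inE => /eqP ->.
  constructor 2; apply/seteqP; split=> x; rewrite Tsemigroup2E -cE.
    move=> Sx; have [->|mx] := S0m x Sx; first by constructor 1.
    have [cx|xc] := leqP c x; first by constructor 3.
    constructor 2; apply/eqP; rewrite -mem_seq1 -lowE lowP asboolT // mx.
    exact: xc.
  by case=> [->//|->//|]; exact: Sc.
have [dE cE mE] := wilf_arithmetic k2 c2m dm dk W.
move: k2; rewrite leq_eqVlt => /predU1P[kE|k3].
  constructor 3; have m3 : m = 3 by rewrite -kE in mE; lia.
  have c6 : c = 6 by lia.
  rewrite m3 c6 in Sm Sc Sc1 S0m kE.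
  (* 5 is [c - 1], hence a gap. As [k = 2] elements lie among 3, 4, 5, the number 4 must be one of
     them. *)
  have S5 : ~ S 5 by [].
  have S4 : S 4.
    move: kE; rewrite /k m3 c6 /low_elements /= asboolT // (asboolF S5).
    by case: asboolP.
  apply/seteqP; split=> x; rewrite generated34E; last first.
    by case=> [->//|->//|->//|]; exact: Sc.
  move=> Sx; have [->|x3] := S0m x Sx; first by constructor 1.
  have [x6|] := leqP 6 x; first by constructor 4.
  case: x x3 Sx => [|[|[|[|[|[|x]]]]]] // _ _ _; first by constructor 2.
  by constructor 3.
(* From [k >= 3] and [2m = k(k+1)] come [m >= 6] and exactly [m] pair sums; [d = m] makes all of
   [[2m, 3m)] decomposable. *)
exfalso; apply: (@no_perfect_additive_basis m (low_elements S m c)).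
- by nia.
- by apply/allP => x; rewrite lowP => /and3P[].
- by move: (size_pair_sums (low_elements S m c)); rewrite -/k -mE; lia.
- have dall : all (fun x => `[< decomposable S x >]) (iota c m).
    by rewrite all_count -size_filter -/(decomposables S m c) -/d dE size_iota.
  move=> x; rewrite -cE => xi; apply: subd.
  by rewrite mem_filter xi andbT; exact: (allP dall).
Qed.

(** * Vanishing of the Wilf number on the listed semigroups *)

Lemma wilf_number_Tsemigroup1 S m : numerical_semigroup S -> S <> setT ->
  2 <= m -> S = Tsemigroup m 1 -> wilf_number S = 0%R.
Proof.
move=> Snum ST m2 SE.
have SP x : S x <-> x = 0 \/ m <= x by rewrite SE Tsemigroup1E.
have mE : multiplicity S = m.
  apply: multiplicityE; [by apply/SP; right|by lia|].
  by move=> x /SP[->|].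
have cE : conductor S = m.
  rewrite -[RHS](ltn_predK m2); apply: conductorE => [/SP|x mx]; first lia.
  by apply/SP; right; lia.
have mm : m <= 2 * m by lia.
apply/(wilf_number_eq0_low Snum ST mE cE mm).
have [_ m0 mmin] := multiplicity_spec Snum; rewrite mE in m0 mmin.
have := size_decomposables_le_low m0 mmin (leqnn m) mm.
(* With [k = 0] the bound forces [d = 0], and the equation reads [m = m]. *)
have -> : size (low_elements S m m) = 0 by rewrite /low_elements subnn.
lia.
Qed.

Lemma wilf_number_Tsemigroup2 S m : numerical_semigroup S -> S <> setT ->
  2 <= m -> S = Tsemigroup m 2 -> wilf_number S = 0%R.
Proof.
move=> Snum ST m2 SE.
have SP x : S x <-> [\/ x = 0, x = m | 2 * m <= x] by rewrite SE Tsemigroup2E.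
have Sm : S m by apply/SP; constructor 2.
have mE : multiplicity S = m.
  by apply: multiplicityE => // [|x /SP[->|->|]] //; lia.
have mm0 : 0 < 2 * m by lia.
have m2m : m <= 2 * m by lia.
have cE : conductor S = 2 * m.
  rewrite -[RHS](prednK mm0); apply: conductorE => [/SP[]|x mx]; try lia.
  by apply/SP; constructor 3; lia.
apply/(wilf_number_eq0_low Snum ST mE cE (leqnn _)).
have [_ m0 mmin] := multiplicity_spec Snum; rewrite mE in m0 mmin.
have dk := size_decomposables_le_low m0 mmin m2m (leqnn (2 * m)).
have lowE : size (low_elements S m (2 * m)) = 1.
  rewrite /low_elements /= (_ : 2 * m - m = m.-1.+1) /=; last lia.
  rewrite asboolT //= (@eq_in_filter _ _ pred0) ?filter_pred0 // => x.
  rewrite mem_iota => xm; apply/asboolPn => /SP[]; lia.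
(* [2m = m + m] gives [d >= 1], while [k = 1] gives [d <= 1]; then [(1 + m - 1) 2 = 2m]. *)
have : 0 < size (decomposables S m (2 * m)).
  rewrite -has_predT; apply/hasP; exists (2 * m) => //.
  rewrite mem_filter mem_iota asboolT; last by exists m, m; split=> //; lia.
  lia.
rewrite lowE in dk *; lia.
Qed.

Lemma wilf_number_34 S : numerical_semigroup S -> S <> setT ->
  S = generated [set 3; 4] -> wilf_number S = 0%R.
Proof.
move=> Snum ST SE.
have SP x : S x <-> [\/ x = 0, x = 3, x = 4 | 6 <= x].
  by rewrite SE generated34E.
have S3 : S 3 by apply/SP; constructor 2.
have S4 : S 4 by apply/SP; constructor 3.
have S5 : ~ S 5 by move/SP=> [].
have mE : multiplicity S = 3.
  apply: multiplicityE => // x /SP[->|->|->|] //; lia.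
have cE : conductor S = 6.
  by apply: conductorE => // x x6; apply/SP; constructor 4.
apply/(wilf_number_eq0_low Snum ST mE cE (leqnn _)).
(* The low elements are 3 and 4, and 6, 7, 8 are all decomposable: [(2 + 3 - 3) 3 = 6]. *)
rewrite /low_elements /decomposables /=.
by rewrite (asboolF S5) !asboolT //; [exists 4, 4|exists 3, 4|exists 3, 3].
Qed.

Theorem theorem1p4 (S : set nat) :
  numerical_semigroup S -> S <> setT ->
  conductor S <= 2 * multiplicity S ->
  (wilf_number S = 0%R <->
   (exists m : nat, 2 <= m /\ (S = Tsemigroup m 1 \/ S = Tsemigroup m 2)) \/
   S = generated [set 3; 4]).
Proof.
move=> Snum ST c2m; split=> [W|[[m [m2 [SE|SE]]]|SE]].
- have m2 := multiplicity_gt1 Snum ST.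
  have [SE|SE|SE] := wilf_number_eq0_cases Snum ST c2m W; last by right.
    by left; exists (multiplicity S); split=> //; left.
  by left; exists (multiplicity S); split=> //; right.
- exact: wilf_number_Tsemigroup1 SE.
- exact: wilf_number_Tsemigroup2 SE.
- exact: wilf_number_34 SE.
Qed.
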